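(* There are constants $c_1,c_2>0$ such that for each $n\in\mathbb{N}$ there exist $N_1,N_2\in\mathbb{N}$ such that $$c_1n^{1/2}(\log(n+1))^{-1}\le\frac{e_n^{\rm ran\text{-}non}\big(J^{N_1,N_2},B_{L_1^{N_1}(L_\infty^{N_2})},L_\infty^{N_1}(L_1^{N_2})\big)}{e_n^{\rm ran}\big(J^{N_1,N_2},B_{L_1^{N_1}(L_\infty^{N_2})},L_\infty^{N_1}(L_1^{N_2})\big)}\le c_2n^{1/2}.$$
   Context: Conventions. $\mathbb{N}=\{1,2,\dots\}$, $\mathbb{N}_0=\mathbb{N}\cup\{0\}$; $\mathbb{K}$ is $\mathbb{R}$ or $\mathbb{C}$; $\log=\log_2$; $B_X$ is the unit ball of a normed space $X$. Spaces. For $1\le p,u\le\infty$, $L_p^N$ is the space of all $f:\{1,\dots,N\}\to\mathbb{K}$ with norm $\|f\|_{L_p^N}=\big(\frac1N\sum_{i=1}^N|f(i)|^p\big)^{1/p}$ for $p<\infty$ and $\|f\|_{L_\infty^N}=\max_i|f(i)|$. $L_p^{N_1}(L_u^{N_2})$ is the space of all $f:\{1,\dots,N_1\}\times\{1,\dots,N_2\}\to\mathbb{K}$ with norm $\big\|(\|f_i\|_{L_u^{N_2}})_{i=1}^{N_1}\big\|_{L_p^{N_1}}$, where $f_i=(f(i,j))_{j=1}^{N_2}$. The solution operator is the identity map $J^{N_1,N_2}:L_1^{N_1}(L_\infty^{N_2})\to L_\infty^{N_1}(L_1^{N_2})$, $J^{N_1,N_2}f=f$. Problem. The input set is $F=B_{L_1^{N_1}(L_\infty^{N_2})}$,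 the target space is $G=L_\infty^{N_1}(L_1^{N_2})$, the solution operator is $S=J^{N_1,N_2}$ (restricted to $F$), and the set of information functionals is $\Lambda=\{\delta_{ij}:1\le i\le N_1,\,1\le j\le N_2\}$, $\delta_{ij}(f)=f(i,j)$, with values in $K=\mathbb{K}$. Deterministic algorithms. A deterministic algorithm is a tuple $A=((L_i)_{i=1}^\infty,(\tau_i)_{i=0}^\infty,(\varphi_i)_{i=0}^\infty)$ with $L_1\in\Lambda$, $\tau_0\in\{0,1\}$, $\varphi_0\in G$, and, for $i\in\mathbb{N}$, arbitrary mappings $L_{i+1}:K^i\to\Lambda$, $\tau_i:K^i\to\{0,1\}$, $\varphi_i:K^i\to G$. For $f\in F$ put $\lambda_1=L_1$, $\lambda_i=L_i(\lambda_1(f),\dots,\lambda_{i-1}(f))$ for $i\ge2$. The cardinality ${\rm card}(A,f)$ is $0$ if $\tau_0=1$; if $\tau_0=0$ it is the first integer $n\ge1$ with $\tau_n(\lambda_1(f),\dots,\lambda_n(f))=1$, or $+\infty$ if there is none. The output is $A(f)=\varphi_0$ if ${\rm card}(A,f)\in\{0,\infty\}$, and $A(f)=\varphi_n(\lambda_1(f),\dots,\lambda_n(f))$ if $1\le{\rm card}(A,f)=n<\infty$. $A$ is non-adaptive if all $L_i$ and all $\tau_i$ are constant. Randomized algorithms. A randomized algorithm is $A=((\Omega,\Sigma,\mathbb{P}),(A_\omega)_{\omega\in\Omega})$ with $(\Omega,\Sigma,\mathbb{P})$ a probability space and each $A_\omega$ a deterministic algorithm. $\mathscr{A}_n^{\rm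 ran}$ ($n\in\mathbb{N}_0$) is the class of randomized algorithms such that for each $f\in F$ the map $\omega\mapsto{\rm card}(A_\omega,f)$ is $\Sigma$-measurable, $\mathbb{E}\,{\rm card}(A_\omega,f)\le n$, and $\omega\mapsto A_\omega(f)$ is $\Sigma$-to-Borel measurable and $\mathbb{P}$-almost surely separably valued. $\mathscr{A}_n^{\rm ran\text{-}non}$ is the subset of those for which $A_\omega$ is non-adaptive for all $\omega\in\Omega$. Minimal errors. $e_n^{\rm ran}(S,F,G)=\inf_{A\in\mathscr{A}_n^{\rm ran}}\sup_{f\in F}\mathbb{E}\,\|S(f)-A_\omega(f)\|_G$, and $e_n^{\rm ran\text{-}non}(S,F,G)$ is defined in the same way with the infimum over $\mathscr{A}_n^{\rm ran\text{-}non}$. *)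

(* Defs.v *)
From HB Require Import structures.
From mathcomp Require Import all_boot all_order all_algebra.
From mathcomp Require Import all_classical all_reals all_analysis.
From mathcomp Require Import measurable_realfun.
From mathcomp Require Import complex.

Set Implicit Arguments.
Unset Strict Implicit.
Unset Printing Implicit Defensive.

Import Order.TTheory GRing.Theory Num.Theory.

Local Open Scope classical_set_scope.
Local Open Scope ring_scope.

Variant scalar_kind := RealScalars | ComplexScalars.

(* [Rcomplex R] is [R[i]] with the modulus as an [R]-valued norm. *)
Definition scalars (R : realType) (k : scalar_kind) : normedZmodType R :=
  match k with
  | RealScalars => R
  | ComplexScalars => Rcomplex R
  end.

Definition log2 (R : realType) (x : R) : R := ln x / ln 2.

(* The exponent ranges over [1, +oo]; the value at [-oo] is a dummy. *)
Definition Lnorm_fin (R : realType) (V : normedZmodType R) (N : nat)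
    (p : \bar R) (f : 'I_N -> V) : R :=
  match p with
  | r%:E => (N%:R^-1 * \sum_(i < N) `|f i| `^ r) `^ r^-1
  | +oo%E => \big[Num.max/0]_(i < N) `|f i|
  | -oo%E => 0
  end.

(* Norm of L_p^{N1}(L_u^{N2}); a function on {1..N1} x {1..N2} is a matrix. *)
Definition mixed_norm (R : realType) (V : normedZmodType R) (N1 N2 : nat)
    (p u : \bar R) (f : 'M[V]_(N1, N2)) : R :=
  Lnorm_fin p (fun i : 'I_N1 => Lnorm_fin u (f i)).

(* A deterministic algorithm with information functionals in [Lam], a set of
   functions [X -> K], and outputs in [G]. The 0-th components, on the unique
   empty tuple, are L_1, tau_0 and phi_0; [query i] is L_{i+1}. *)
Record det_alg (X K G : Type) (Lam : set (X -> K)) := DetAlg {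
  query : forall i : nat, i.-tuple K -> X -> K;
  query_in : forall (i : nat) (a : i.-tuple K), Lam (query a);
  stop : forall i : nat, i.-tuple K -> bool;
  output : forall i : nat, i.-tuple K -> G
}.

(* (lambda_1(f), ..., lambda_i(f)) *)
Fixpoint info (X K G : Type) (Lam : set (X -> K)) (A : det_alg G Lam) (f : X)
    (i : nat) : i.-tuple K :=
  match i with
  | 0 => [tuple]
  | j.+1 => rcons_tuple (info A f j) (query A (info A f j) f)
  end.

(* [None] when the algorithm never stops. *)
Definition stop_time (X K G : Type) (Lam : set (X -> K)) (A : det_alg G Lam)
    (f : X) : option nat :=
  match pselect (exists n, stop A (info A f n)) with
  | left ex => Some (ex_minn ex)
  | right _ => None
  end.

Definition card_alg (R : realType) (X K G : Type) (Lam : set (X -> K))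
    (A : det_alg G Lam) (f : X) : \bar R :=
  if stop_time A f is Some n then n%:R%:E else +oo%E.

Definition run (X K G : Type) (Lam : set (X -> K)) (A : det_alg G Lam)
    (f : X) : G :=
  if stop_time A f is Some n then output A (info A f n)
  else output A [tuple].

Definition nonadaptive (X K G : Type) (Lam : set (X -> K))
    (A : det_alg G Lam) : Prop :=
  forall (i : nat) (a b : i.-tuple K),
    query A a = query A b /\ stop A a = stop A b.

(* The topology, Borel sets and separability of [G] are those of the norm
   [nG], which need not be a canonical norm on the type [G]. *)
Definition norm_open (R : realType) (G : zmodType) (nG : G -> R) :
    set (set G) :=
  [set U | forall x, U x -> exists2 e, 0 < e & ball_ nG x e `<=` U].

Definition norm_borel (R : realType) (G : zmodType) (nG : G -> R) :
    set (set G) := <<s norm_open nG >>.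

Definition norm_separable (R : realType) (G : zmodType) (nG : G -> R)
    (Y : set G) : Prop :=
  exists D : set G, [/\ countable D, D `<=` Y &
    forall y e, Y y -> 0 < e -> exists2 x, D x & ball_ nG y e x].

Definition ran_class (R : realType) (X K : Type) (G : zmodType)
    (Lam : set (X -> K)) (F : set X) (nG : G -> R) (n : nat)
    (d : measure_display) (T : measurableType d) (P : probability T R)
    (A : T -> det_alg G Lam) : Prop :=
  forall f, F f ->
    [/\ measurable_fun [set: T] (fun w => card_alg R (A w) f),
        (\int[P]_w card_alg R (A w) f <= n%:R%:E)%E,
        forall B, norm_borel nG B ->
          measurable ((fun w => run (A w) f) @^-1` B) &
        exists2 Y, norm_separable nG Y & {ae P, forall w, Y (run (A w) f)}].

Definition ran_error (R : realType) (X K : Type) (G : zmodType)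
    (Lam : set (X -> K)) (S : X -> G) (F : set X) (nG : G -> R)
    (d : measure_display) (T : measurableType d) (P : probability T R)
    (A : T -> det_alg G Lam) : \bar R :=
  ereal_sup [set (\int[P]_w (nG (S f - run (A w) f))%:E)%E | f in F].

Definition e_ran (R : realType) (X K : Type) (G : zmodType)
    (Lam : set (X -> K)) (S : X -> G) (F : set X) (nG : G -> R) (n : nat) :
    \bar R :=
  ereal_inf [set e | exists (d : measure_display) (T : measurableType d)
      (P : probability T R) (A : T -> det_alg G Lam),
    ran_class F nG n P A /\ e = ran_error S F nG P A].

Definition e_ran_non (R : realType) (X K : Type) (G : zmodType)
    (Lam : set (X -> K)) (S : X -> G) (F : set X) (nG : G -> R) (n : nat) :
    \bar R :=
  ereal_inf [set e | exists (d : measure_display) (T : measurableType d)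
      (P : probability T R) (A : T -> det_alg G Lam),
    [/\ ran_class F nG n P A, forall w, nonadaptive (A w) &
        e = ran_error S F nG P A]].

Definition point_evals (V : Type) (N1 N2 : nat) : set ('M[V]_(N1, N2) -> V) :=
  [set L | exists (i : 'I_N1) (j : 'I_N2), L = fun f : 'M[V]_(N1, N2) => f i j].

(* The identity L_1^{N1}(L_oo^{N2}) -> L_oo^{N1}(L_1^{N2}). *)
Definition J (V : Type) (N1 N2 : nat) (f : 'M[V]_(N1, N2)) : 'M[V]_(N1, N2) :=
  f.

Definition mixed_ball (R : realType) (V : normedZmodType R) (N1 N2 : nat)
    (p u : \bar R) : set 'M[V]_(N1, N2) :=
  [set f | mixed_norm p u f <= 1].

(* Main.v *)
Require Import Defs.
From HB Require Import structures.
From mathcomp Require Import all_boot all_order all_algebra.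
From mathcomp Require Import all_classical all_reals all_analysis.
From mathcomp Require Import measurable_realfun.
From mathcomp Require Import complex.
From mathcomp Require Import ring lra zify.

Set Implicit Arguments.
Unset Strict Implicit.
Unset Printing Implicit Defensive.

Import Order.TTheory GRing.Theory Num.Theory.

Local Open Scope classical_set_scope.
Local Open Scope ring_scope.

(** Write [e] for the minimal errors of adaptive, [e'] for those of
    non-adaptive randomized algorithms. For [n > 1] take [N1 = s] and
    [N2 = 16 * s] with [2 * s ^ 2 <= n <= 8 * s ^ 2], so that an algorithm reads
    on average at most half of the [N1 * N2] entries.

    Lower bounds. The sign of an entry that is not read cannot be guessed: when
    it is flipped, the run does not change, so the two errors at that entry add
    up to at least twice the modulus of the entry ([unread_signs_error],
    [signs_error]). Random signs on the whole matrix are in the ball and give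
    [1 / 2 <= e] ([e_ran_ge]). Random signs of modulus [N1] on one row are in
    the ball too. A non-adaptive algorithm reads the same entries whichever row
    was chosen, hence misses on average at least half of that row, and
    [N1 / 2 <= e'] ([e_ran_non_ge]).

    Upper bounds. The zero output gives [e' <= N1] ([e_ran_le_zero]). An
    adaptive algorithm can do much better ([e_ran_le_screening]): it reads [s]
    random columns and then completely those rows in which an entry of modulus
    at least [16] showed up. The sum over the rows of the largest modulus is at
    most [s], so at most [s / 16] rows are read completely, and the total cost
    is at most [s ^ 2 + s / 16 * (16 * s) = 2 * s ^ 2 <= n]. A row that is not
    read completely contributes at most [16] through its small entries. If its
    large entries contribute more than [t] to the mean, they fill more than a
    fraction [t / s] of the row, and all [s] columns miss them with probability
    at most [expR (- t)] ([heavy_row_missed]). A missed row costs at most [s]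
    and there are [s] rows, so the expected error is at most
    [16 + t + s ^ 2 * expR (- t)] ([screening_mean_error]), which is
    [17 + 2 * ln s] for [t = 2 * ln s].

    Hence [e' / e] is at most [2 * s] and at least [(s / 2) / (17 + 2 * ln s)],
    where [s] is of the order of the square root of [n]. For [n = 1] a matrix
    with one row and two columns suffices. *)

(** * The mixed norms *)

Lemma mixed_norm_1ooE (R : realType) (V : normedZmodType R) (N1 N2 : nat)
    (f : 'M[V]_(N1, N2)) :
  mixed_norm 1%:E +oo%E f
  = N1%:R^-1 * \sum_(i < N1) \big[Num.max/0]_(j < N2) `|f i j|.
Proof.
have max_ge0 i : 0 <= \big[Num.max/0]_(j < N2) `|f i j|.
  exact: bigmax_ge_id.
rewrite /mixed_norm /Lnorm_fin invr1 powRr1; last first.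
  by rewrite mulr_ge0 ?invr_ge0 // sumr_ge0 // => i _; rewrite powR_ge0.
by congr (_ * _); apply: eq_bigr => i _; rewrite powRr1 // ger0_norm.
Qed.

Lemma mixed_norm_oo1E (R : realType) (V : normedZmodType R) (N1 N2 : nat)
    (f : 'M[V]_(N1, N2)) :
  mixed_norm +oo%E 1%:E f
  = \big[Num.max/0]_(i < N1) (N2%:R^-1 * \sum_(j < N2) `|f i j|).
Proof.
have mean_ge0 i : 0 <= N2%:R^-1 * \sum_(j < N2) `|f i j|.
  by rewrite mulr_ge0 ?invr_ge0 // sumr_ge0.
apply: eq_bigr => i _; rewrite ger0_norm; last exact: powR_ge0.
rewrite /Lnorm_fin invr1 powRr1.
  by congr (_ * _); apply: eq_bigr => j _; rewrite powRr1.
by rewrite mulr_ge0 ?invr_ge0 // sumr_ge0 // => j _; rewrite powR_ge0.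
Qed.

Lemma mixed_norm_oo1_ge0 (R : realType) (V : normedZmodType R) (N1 N2 : nat)
    (f : 'M[V]_(N1, N2)) : 0 <= mixed_norm +oo%E 1%:E f.
Proof. by rewrite mixed_norm_oo1E bigmax_ge_id. Qed.

Lemma mixed_norm_oo1_le (R : realType) (V : normedZmodType R) (N1 N2 : nat)
    (f : 'M[V]_(N1, N2)) (b : R) : 0 <= b ->
  (forall i, N2%:R^-1 * \sum_(j < N2) `|f i j| <= b) ->
  mixed_norm +oo%E 1%:E f <= b.
Proof. by move=> b0 fb; rewrite mixed_norm_oo1E; exact: bigmax_le. Qed.

Lemma row_mean_le (R : realType) (V : normedZmodType R) (N1 N2 : nat)
    (f : 'M[V]_(N1, N2)) (i : 'I_N1) :
  N2%:R^-1 * \sum_(j < N2) `|f i j| <= mixed_norm +oo%E 1%:E f.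
Proof.
by rewrite mixed_norm_oo1E; exact: (le_bigmax _ _ i).
Qed.

Lemma mixed_norm_oo1D (R : realType) (V : normedZmodType R) (N1 N2 : nat)
    (f g : 'M[V]_(N1, N2)) :
  mixed_norm +oo%E 1%:E (f + g)
  <= mixed_norm +oo%E 1%:E f + mixed_norm +oo%E 1%:E g.
Proof.
apply: mixed_norm_oo1_le; first by rewrite addr_ge0 ?mixed_norm_oo1_ge0.
move=> i; apply: le_trans (lerD (row_mean_le f i) (row_mean_le g i)).
rewrite -mulrDr ler_wpM2l ?invr_ge0 // -big_split ler_sum // => j _.
by rewrite mxE ler_normD.
Qed.

Lemma mixed_norm_oo1_0 (R : realType) (V : normedZmodType R) (N1 N2 : nat) :
  mixed_norm +oo%E 1%:E (0 : 'M[V]_(N1, N2)) = 0.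
Proof.
apply/le_anti; rewrite mixed_norm_oo1_ge0 andbT.
apply: mixed_norm_oo1_le => // i; rewrite big1 ?mulr0 // => j _.
by rewrite mxE normr0.
Qed.

(** * Lower bounds by averaging over test inputs *)

(** The triangle inequality makes open balls open for [norm_open]; this is what
    turns Borel measurability of the output into that of the error. *)
Lemma norm_borel_lt (R : realType) (G : zmodType) (nG : G -> R) (x : G) (r : R) :
  (forall a b, nG (a + b) <= nG a + nG b) ->
  norm_borel nG [set y | nG (x - y) < r].
Proof.
move=> nGD; apply: sub_sigma_algebra => y /= xyr.
exists (r - nG (x - y)); first by rewrite subr_gt0.
move=> z; rewrite /ball_ /= => yzr.
rewrite -(subrK y x) -addrA; apply: le_lt_trans (nGD _ _) _.
by rewrite -ltrBrDl.
Qed.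

Lemma measurable_err (R : realType) (X K : Type) (G : zmodType)
    (Lam : set (X -> K)) (F : set X) (nG : G -> R) (n : nat)
    (d : measure_display) (T : measurableType d) (P : probability T R)
    (A : T -> det_alg G Lam) (f : X) (x : G) :
  (forall a b, nG (a + b) <= nG a + nG b) ->
  ran_class F nG n P A -> F f ->
  measurable_fun setT (fun w => (nG (x - run (A w) f))%:E).
Proof.
move=> nGD /[apply] -[_ _ borel_run _].
apply/measurable_EFinP.
apply: (measurability _ (RGenInftyO.measurableE R)).
move=> _ [_ [r ->] <-]; rewrite setTI.
rewrite [X in measurable X](_ : _ =
  (fun w => run (A w) f) @^-1` [set y | nG (x - y) < r]).
  by apply: borel_run; exact: norm_borel_lt.
by apply/seteqP; split=> w /=; rewrite in_itv.
Qed.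

Lemma ran_error_ge0 (R : realType) (X K : Type) (G : zmodType)
    (Lam : set (X -> K)) (S : X -> G) (F : set X) (nG : G -> R)
    (d : measure_display) (T : measurableType d) (P : probability T R)
    (A : T -> det_alg G Lam) (f : X) :
  (forall x, 0 <= nG x) -> F f -> (0 <= ran_error S F nG P A)%E.
Proof.
move=> nG0 Ff; apply: le_trans (ereal_sup_ubound _); last by exists f.
by apply: integral_ge0 => w _; rewrite lee_fin.
Qed.

(** Yao's principle: a bound on the total error plus cost of each deterministic
    algorithm over a finite family of inputs integrates to a bound for the
    worst input of a randomized algorithm. The cost enters as the summand
    [card_alg], so that runs that never stop need no separate treatment. *)
Lemma ran_error_ge_avg (R : realType) (X K : Type) (G : zmodType)
    (Lam : set (X -> K)) (S : X -> G) (F : set X) (nG : G -> R) (n : nat)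
    (d : measure_display) (T : measurableType d) (P : probability T R)
    (A : T -> det_alg G Lam) (I : finType) (f : I -> X) (a c : R) :
  (forall x, 0 <= nG x) -> (forall x y, nG (x + y) <= nG x + nG y) ->
  ran_class F nG n P A -> (forall t, F (f t)) -> 0 <= a ->
  (forall w, c%:E <= \sum_(t : I)
     ((a * nG (S (f t) - run (A w) (f t)))%:E + card_alg R (A w) (f t)))%E ->
  (c%:E <= \sum_(t : I) (a%:E * ran_error S F nG P A + n%:R%:E))%E.
Proof.
move=> nG0 nGD clA Ff a0 Hc.
have card0 w t : (0 <= card_alg R (A w) (f t))%E.
  by rewrite /card_alg; case: stop_time => // m; rewrite lee_fin.
have err0 w t : (0 <= (a * nG (S (f t) - run (A w) (f t)))%:E)%E.
  by rewrite lee_fin mulr_ge0.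
have merr t : measurable_fun setT (fun w => (nG (S (f t) - run (A w) (f t)))%:E).
  exact: measurable_err clA (Ff t).
have maerr t :
    measurable_fun setT (fun w => (a * nG (S (f t) - run (A w) (f t)))%:E).
  by under eq_fun do rewrite EFinM; exact: emeasurable_funM.
have mcard t : measurable_fun setT (fun w => card_alg R (A w) (f t)).
  by have [] := clA _ (Ff t).
have mterm t : measurable_fun setT (fun w =>
    ((a * nG (S (f t) - run (A w) (f t)))%:E + card_alg R (A w) (f t))%E).
  exact: emeasurable_funD.
have term0 w t : (0 <= (a * nG (S (f t) - run (A w) (f t)))%:E
    + card_alg R (A w) (f t))%E by rewrite adde_ge0.
have [c0|c0] := leP 0 c; last first.
  apply: (@le_trans _ _ 0%E); first by rewrite lee_fin ltW.
  apply: sume_ge0 => t _; rewrite adde_ge0 ?lee_fin // mule_ge0 ?lee_fin //.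
  exact: ran_error_ge0 (Ff t).
have -> : (c%:E = \int[P]_w c%:E)%E.
  by rewrite integral_cst //= probability_setT mule1.
apply: (@le_trans _ _ (\int[P]_w \sum_(t : I)
   ((a * nG (S (f t) - run (A w) (f t)))%:E + card_alg R (A w) (f t)))%E).
  apply: ge0_le_integral => //.
  by apply: emeasurable_sum.
rewrite ge0_integral_sum //.
apply: lee_sum => t _; rewrite ge0_integralD //.
apply: leeD; last by have [] := clA _ (Ff t).
under eq_integral do rewrite EFinM.
rewrite ge0_integralZl_EFin //; last by move=> w _; rewrite lee_fin.
apply: lee_wpmul2l; first by rewrite lee_fin.
by apply: ereal_sup_ubound; exists (f t).
Qed.

(** * Entries read by an algorithm *)

Lemma stop_timeP (X K G : Type) (Lam : set (X -> K)) (A : det_alg G Lam)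
    (f : X) (m : nat) :
  stop_time A f = Some m <->
  stop A (info A f m) /\ forall k, (k < m)%N -> ~~ stop A (info A f k).
Proof.
rewrite /stop_time; case: pselect => [ex|nex]; last first.
  by split=> // -[fm _]; case: nex; exists m.
case: ex_minnP => m0 fm0 m0_min; split=> [[<-]|[fm m_min]].
  by split=> // k; rewrite ltnNge; apply: contra => /m0_min.
congr Some; apply/eqP; rewrite eqn_leq m0_min //= leqNgt.
by apply/negP => /m_min; rewrite fm0.
Qed.

Lemma info_stop_time_eq (X K G : Type) (Lam : set (X -> K))
    (A : det_alg G Lam) (f g : X) (m : nat) :
  stop_time A f = Some m ->
  (forall k, (k < m)%N ->
     query A (info A f k) f = query A (info A f k) g) ->
  (forall k, (k <= m)%N -> info A g k = info A f k) /\
  stop_time A g = Some m.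
Proof.
move=> /stop_timeP[fm f_min] fg.
have infoE k : (k <= m)%N -> info A g k = info A f k.
  elim: k => [|k IHk] // km /=.
  by rewrite IHk ?(ltnW km) // fg.
split=> //; apply/stop_timeP; split; first by rewrite infoE.
by move=> k km; rewrite infoE ?f_min // ltnW.
Qed.

Definition eval_pos (V : Type) (N1 N2 : nat) (L : 'M[V]_(N1, N2) -> V) :
    option ('I_N1 * 'I_N2) :=
  [pick p : 'I_N1 * 'I_N2 | `[< L = fun f => f p.1 p.2 >] ].

Lemma eval_posP (V : Type) (N1 N2 : nat) (L : 'M[V]_(N1, N2) -> V) :
  point_evals L ->
  exists2 p, eval_pos L = Some p & forall f, L f = f p.1 p.2.
Proof.
move=> [i [j Lij]]; rewrite /eval_pos; case: pickP => [p /asboolP -> |none].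
  by exists p.
by have /negP[] := negbT (none (i, j)); apply/asboolP.
Qed.

(** A run that never stops counts as reading everything: its cardinality is
    infinite, and its output may depend on every entry. *)
Definition queried (V G : Type) (N1 N2 : nat)
    (A : det_alg G (@point_evals V N1 N2)) (f : 'M[V]_(N1, N2)) :
    {set 'I_N1 * 'I_N2} :=
  if stop_time A f is Some m
  then [set p in pmap (fun k => eval_pos (query A (info A f k))) (iota 0 m)]
  else [set: 'I_N1 * 'I_N2]%SET.

Lemma card_queried (R : realType) (V G : Type) (N1 N2 : nat)
    (A : det_alg G (@point_evals V N1 N2)) (f : 'M[V]_(N1, N2)) :
  (#|queried A f|%:R%:E <= card_alg R A f)%E.
Proof.
rewrite /queried /card_alg; case: stop_time => [m|]; last exact: leey.
rewrite lee_fin ler_nat cardsE; apply: leq_trans (card_size _) _.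
by rewrite size_pmap (leq_trans (count_size _ _)) // size_iota.
Qed.

(** This is where non-adaptivity enters; note that [eval_pos] depends on the
    functional only, not on the answers that led to it. *)
Lemma queried_nonadaptive (V G : Type) (N1 N2 : nat)
    (A : det_alg G (@point_evals V N1 N2)) (f g : 'M[V]_(N1, N2)) :
  nonadaptive A -> queried A f = queried A g.
Proof.
move=> nonA.
have stopE m : stop A (info A f m) = stop A (info A g m).
  by have [] := nonA m (info A f m) (info A g m).
have -> : queried A g = if stop_time A f is Some m
    then [set p in pmap (fun k => eval_pos (query A (info A g k))) (iota 0 m)]
    else [set: 'I_N1 * 'I_N2]%SET.
  rewrite /queried; suff -> : stop_time A g = stop_time A f by [].
  case fE : (stop_time A f) => [m|].
    apply/stop_timeP; have /stop_timeP[fm f_min] := fE.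
    by split=> [|k km]; rewrite -stopE ?f_min.
  case gE : (stop_time A g) => [m|] //; have /stop_timeP[gm g_min] := gE.
  rewrite -fE; apply/esym/stop_timeP.
  by split=> [|k km]; rewrite stopE ?g_min.
rewrite /queried; case: stop_time => [m|] //.
apply/setP => p; rewrite !inE; congr (_ \in _).
apply: eq_pmap => k.
by have [-> _] := nonA k (info A f k) (info A g k).
Qed.

(** An entry that is not read can be changed without affecting the run. *)
Lemma unqueried_run (V G : Type) (N1 N2 : nat)
    (A : det_alg G (@point_evals V N1 N2)) (f g : 'M[V]_(N1, N2))
    (p : 'I_N1 * 'I_N2) :
  p \notin queried A f ->
  (forall q, q != p -> f q.1 q.2 = g q.1 q.2) ->
  queried A g = queried A f /\ run A g = run A f.
Proof.
rewrite /queried; case fE : (stop_time A f) => [m|]; last by rewrite inE.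
rewrite inE mem_pmap => /mapP pf fg.
have [|infoE gE] := info_stop_time_eq fE (g := g).
  move=> k km; have [q qE qP] := eval_posP (query_in A (info A f k)).
  rewrite !qP; apply: fg; apply/eqP => qp; apply: pf; exists k => //.
    by rewrite mem_iota.
  by rewrite qE qp.
rewrite gE; split; last by rewrite /run gE fE infoE.
apply/setP => q; rewrite !inE !mem_pmap.
apply: (congr1 (fun s : seq _ => Some q \in s)).
by apply/eq_in_map => k; rewrite mem_iota => /andP[_ km]; rewrite infoE // ltnW.
Qed.

(** * Random signs *)

Definition sign_mx (V : zmodType) (N1 N2 : nat) (B : {set 'I_N1 * 'I_N2})
    (v : V) (s : {set 'I_N1 * 'I_N2}) : 'M[V]_(N1, N2) :=
  \matrix_(i, j) if (i, j) \in B then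
    if (i, j) \in s then v else - v else 0.

Definition flip (T : finType) (p : T) (s : {set T}) : {set T} :=
  [set q | (q == p) (+) (q \in s)].

Lemma flipK (T : finType) (p : T) : involutive (flip p).
Proof. by move=> s; apply/setP => q; rewrite !inE addbA addbb. Qed.

(** Flipping the sign at [p] is an involution of the patterns for which [p] is
    not read, and it leaves the output there unchanged. The errors [|v - y|] and
    [|- v - y|] of a pair add up to at least [2 * |v|]. *)
Lemma unread_signs_error (R : realType) (V : normedZmodType R) (N1 N2 : nat)
    (A : det_alg 'M[V]_(N1, N2) (@point_evals V N1 N2))
    (B : {set 'I_N1 * 'I_N2}) (v : V) (p : 'I_N1 * 'I_N2) :
  p \in B ->
  \sum_(s | p \notin queried A (sign_mx B v s)) `|v|
  <= \sum_(s | p \notin queried A (sign_mx B v s))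
       `|(sign_mx B v s - run A (sign_mx B v s)) p.1 p.2|.
Proof.
move=> pB; set f := sign_mx B v.
have flip_off s q : q != p -> f s q.1 q.2 = f (flip p s) q.1 q.2.
  by move=> qp; rewrite !mxE -surjective_pairing inE (negPf qp).
have flipP s : p \notin queried A (f s) ->
    queried A (f (flip p s)) = queried A (f s) /\
    run A (f (flip p s)) = run A (f s).
  by move=> ps; apply: (unqueried_run ps) => q; exact: flip_off.
have flip_mem s :
    (p \notin queried A (f (flip p s))) = (p \notin queried A (f s)).
  apply/idP/idP => ps; last by have [-> _] := flipP s ps.
  by have [] := flipP _ ps; rewrite flipK => -> _.
rewrite -(ler_pMn2r (n := 2)) //.
rewrite [leRHS]mulr2n [X in _ + X](reindex_inj (inv_inj (flipK p))) /=.
rewrite [X in _ + X](eq_bigl _ _ flip_mem).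
rewrite -sumrMnl -big_split; apply: ler_sum => s ps /=.
have [_ ->] := flipP s ps.
rewrite -normrMn !mxE -surjective_pairing pB inE eqxx addTb.
set y := run A (f s) p.1 p.2.
apply: (@le_trans _ _ `|(v - y) - (- v - y)|).
  by rewrite opprD !opprK addrACA addNr addr0 mulr2n.
apply: le_trans (ler_normB _ _) _.
by case: (p \in s) => //=; rewrite addrC.
Qed.

(** Signs on the entries that an algorithm does not read cannot be guessed. *)
Lemma signs_error (R : realType) (V : normedZmodType R) (N1 N2 : nat)
    (A : det_alg 'M[V]_(N1, N2) (@point_evals V N1 N2))
    (B : {set 'I_N1 * 'I_N2}) (v : V) :
  \sum_(s : {set 'I_N1 * 'I_N2}) `|v| * #|B|%:R
  <= \sum_s
       (\sum_(p in B) `|(sign_mx B v s - run A (sign_mx B v s)) p.1 p.2|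
        + `|v| * #|B :&: queried A (sign_mx B v s)|%:R).
Proof.
set f := sign_mx B v.
have cardE s : (#|B|%:R : R)
    = \sum_(p in B) (p \notin queried A (f s))%:R
      + #|B :&: queried A (f s)|%:R.
  rewrite -natr_sum -natrD -(cardsID (queried A (f s)) B) addnC.
  congr (_ + _)%:R; rewrite -sum1_card.
  rewrite (eq_bigl (fun p => (p \in B) && (p \notin queried A (f s)))).
    by rewrite big_mkcondr; apply: eq_bigr => p _; case: ifP.
  by move=> p; rewrite inE andbC.
under eq_bigr => s _ do rewrite (cardE s) mulrDr.
rewrite 2!big_split /= lerD2r.
under eq_bigr do rewrite mulr_sumr.
rewrite exchange_big [leRHS]exchange_big /=.
apply: ler_sum => p pB.
apply: (@le_trans _ _ (\sum_(s | p \notin queried A (f s))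
       `|(f s - run A (f s)) p.1 p.2|)); last first.
  rewrite [leRHS](bigID (fun s => p \notin queried A (f s))) /= lerDl.
  exact: sumr_ge0.
apply: le_trans (unread_signs_error A v pB).
rewrite [leRHS]big_mkcond; apply: ler_sum => s _.
by case: ifP => _; rewrite (mulr1, mulr0).
Qed.

(** In the applications [b] is the error of an algorithm that reads nothing, and
    each entry read lowers it by at most [1 / a]. An expected cost of at most
    half of [a * b] therefore leaves half of the error. *)
Lemma ran_error_ge_half (R : realType) (X K : Type) (G : zmodType)
    (Lam : set (X -> K)) (S : X -> G) (F : set X) (nG : G -> R) (n : nat)
    (d : measure_display) (T : measurableType d) (P : probability T R)
    (A : T -> det_alg G Lam) (I : finType) (f : I -> X) (a b : R) :
  (forall x, 0 <= nG x) -> (forall x y, nG (x + y) <= nG x + nG y) ->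
  ran_class F nG n P A -> (forall t, F (f t)) ->
  (0 < #|I|)%N -> 0 < a -> 2 * n%:R <= a * b ->
  (forall w, (\sum_(t : I) (a * b))%:E <= \sum_(t : I)
     ((a * nG (S (f t) - run (A w) (f t)))%:E + card_alg R (A w) (f t)))%E ->
  ((b / 2)%:E <= ran_error S F nG P A)%E.
Proof.
move=> nG0 nGD clA Ff I0 a0 nab Hc.
have [t _] : exists t : I, t \in I by apply/card_gt0P.
have := ran_error_ge0 S P A nG0 (Ff t).
have := ran_error_ge_avg nG0 nGD clA Ff (ltW a0) Hc.
case: ran_error => [e| |] //; last by rewrite !leey.
rewrite -EFinM -EFinD sumEFin !lee_fin !sumr_const ler_pMn2r // => abe _.
nra.
Qed.

Definition rows (N1 N2 : nat) (I : {set 'I_N1}) : {set 'I_N1 * 'I_N2} :=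
  [set p | p.1 \in I].

(** The ball constrains the sum over the rows of the largest modulus, so a few
    rows may carry large entries: [v] may have norm [N1] when [I] is one row. *)
Lemma sign_mx_ball (R : realType) (V : normedZmodType R) (N1 N2 : nat)
    (I : {set 'I_N1}) (v : V) (s : {set 'I_N1 * 'I_N2}) :
  (0 < N1)%N -> `|v| * #|I|%:R <= N1%:R ->
  mixed_ball 1%:E +oo%E (sign_mx (rows N2 I) v s).
Proof.
move=> N1_gt0 vI; rewrite /mixed_ball /mkset mixed_norm_1ooE.
rewrite mulrC ler_pdivrMr ?ltr0n // mul1r; apply: le_trans vI.
rewrite -sum1_card natr_sum mulr_sumr [leRHS]big_mkcond /=.
apply: ler_sum => i _; apply: bigmax_le => [|j _]; first by case: ifP.
rewrite mxE inE /=; case: ifP => _; last by rewrite normr0.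
by case: ifP => _; rewrite ?normrN mulr1.
Qed.

Lemma rows_error (R : realType) (V : normedZmodType R) (N1 N2 : nat)
    (I : {set 'I_N1}) (f : 'M[V]_(N1, N2)) : (0 < N2)%N ->
  \sum_(p in rows N2 I) `|f p.1 p.2|
  <= #|I|%:R * N2%:R * mixed_norm +oo%E 1%:E f.
Proof.
move=> N2_gt0.
rewrite (eq_bigl (fun p => (p.1 \in I) && xpredT p.2)); last first.
  by move=> p; rewrite inE andbT.
rewrite -(pair_big (mem I) xpredT (fun i j => `|f i j|)) /=.
rewrite -mulrA mulr_natl -sumr_const; apply: ler_sum => i _.
by rewrite mulrC -ler_pdivrMr ?ltr0n // mulrC row_mean_le.
Qed.

Lemma card_rows (N1 N2 : nat) (I : {set 'I_N1}) :
  #|rows N2 I| = (#|I| * N2)%N.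
Proof.
rewrite -[N2 in RHS]card_ord -cardsT -cardsX; apply: eq_card => p.
by rewrite !inE andbT.
Qed.

(** * Lower bounds for the minimal errors *)

(** Test inputs: the matrices with all entries [u] or [- u]. *)
Lemma e_ran_ge (R : realType) (V : normedZmodType R) (u : V) (N1 N2 n : nat) :
  `|u| = 1 -> (0 < N1)%N -> (0 < N2)%N -> (2 * n <= N1 * N2)%N ->
  ((1 / 2)%:E <= e_ran (@point_evals V N1 N2) (@J V N1 N2)
     (mixed_ball 1%:E +oo%E) (mixed_norm +oo%E 1%:E) n)%E.
Proof.
move=> u1 N1_gt0 N2_gt0 nN.
apply/ereal_infP => _ [d [T [P [A [clA ->]]]]].
pose f := sign_mx (rows N2 [set: 'I_N1]) u.
apply: (ran_error_ge_half (f := f) (a := N1%:R * N2%:R)) clA _ _ _ _ _.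
- exact: mixed_norm_oo1_ge0.
- exact: mixed_norm_oo1D.
- by move=> s; apply: sign_mx_ball; rewrite ?u1 ?cardsT ?card_ord ?mul1r.
- by apply/card_gt0P; exists finset.set0.
- by rewrite mulr_gt0 ?ltr0n.
- by rewrite mulr1 -!natrM ler_nat.
move=> w; apply: (@le_trans _ _ (\sum_s
   ((N1%:R * N2%:R * mixed_norm +oo%E 1%:E (J (f s) - run (A w) (f s)))
     + #|queried (A w) (f s)|%:R)%:E)%E).
  rewrite sumEFin lee_fin.
  have := signs_error (A w) (rows N2 [set: 'I_N1]) u.
  rewrite -/f u1 card_rows cardsT card_ord natrM mul1r mulr1 => /le_trans; apply.
  apply: ler_sum => s _; rewrite mul1r; apply: lerD.
    by have := rows_error [set: 'I_N1] (f s - run (A w) (f s)) N2_gt0;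
       rewrite cardsT card_ord.
  by rewrite ler_nat subset_leq_card // subsetIr.
by apply: lee_sum => s _; rewrite EFinD leeD2l // card_queried.
Qed.

(** Test inputs: one row with entries [+- N1 * u], the others zero. All rows
    compete for the same budget, because the set of entries that are read does
    not depend on the row that was chosen. *)
Lemma e_ran_non_ge (R : realType) (V : normedZmodType R) (u : V)
    (N1 N2 n : nat) :
  `|u| = 1 -> (0 < N1)%N -> (0 < N2)%N -> (2 * n <= N1 * N2)%N ->
  ((N1%:R / 2)%:E <= e_ran_non (@point_evals V N1 N2) (@J V N1 N2)
     (mixed_ball 1%:E +oo%E) (mixed_norm +oo%E 1%:E) n)%E.
Proof.
move=> u1 N1_gt0 N2_gt0 nN.
apply/ereal_infP => _ [d [T [P [A [clA nonA ->]]]]].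
pose v := u *+ N1.
have v_norm : `|v| = N1%:R by rewrite normrMn u1.
pose f (t : 'I_N1 * {set 'I_N1 * 'I_N2}) := sign_mx (rows N2 [set t.1]) v t.2.
apply: (ran_error_ge_half (f := f) (a := N2%:R)) clA _ _ _ _ _.
- exact: mixed_norm_oo1_ge0.
- exact: mixed_norm_oo1D.
- by move=> t; apply: sign_mx_ball; rewrite ?v_norm ?cards1 ?mulr1.
- by apply/card_gt0P; exists (Ordinal N1_gt0, finset.set0).
- by rewrite ltr0n.
- by rewrite -!natrM ler_nat [leqRHS]mulnC.
move=> w; set Q := queried (A w) 0.
have QE t : queried (A w) (f t) = Q by apply: queried_nonadaptive.
apply: (@le_trans _ _ (\sum_t
   (N2%:R * mixed_norm +oo%E 1%:E (J (f t) - run (A w) (f t))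
     + #|Q|%:R)%:E)%E); last first.
  by apply: lee_sum => t _; rewrite EFinD leeD2l // -(QE t) card_queried.
rewrite sumEFin lee_fin.
(* The rows partition the set read by the algorithm, whatever the input. *)
have cardQ : \sum_(i : 'I_N1) N1%:R * #|rows N2 [set i] :&: Q|%:R
    = \sum_(i : 'I_N1) #|Q|%:R :> R.
  rewrite -mulr_sumr sumr_const card_ord -[RHS]mulr_natl; congr (_ * _).
  rewrite -natr_sum -sum1_card (partition_big fst xpredT) //=.
  congr (_%:R); apply: eq_bigr => i _.
  by rewrite -sum1_card; apply: eq_bigl => p; rewrite !inE andbC.
pose err i s := mixed_norm +oo%E 1%:E (f (i, s) - run (A w) (f (i, s))).
rewrite -(pair_bigA _ (fun _ _ => N2%:R * N1%:R)).
rewrite [leRHS](eq_bigr (fun t => N2%:R * err t.1 t.2 + #|Q|%:R)); last by case.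
rewrite -(pair_bigA _ (fun i s => N2%:R * err i s + #|Q|%:R)).
apply: (@le_trans _ _ (\sum_(i : 'I_N1) \sum_(s : {set 'I_N1 * 'I_N2})
  (N2%:R * err i s + N1%:R * #|rows N2 [set i] :&: Q|%:R))).
  apply: ler_sum => i _.
  have := signs_error (A w) (rows N2 [set i]) v.
  rewrite v_norm card_rows cards1 mul1n mulrC => /le_trans; apply.
  apply: ler_sum => s _; apply: lerD; last by rewrite -[X in queried _ X]/(f (i, s)) QE.
  by have := rows_error [set i] (f (i, s) - run (A w) (f (i, s))) N2_gt0;
     rewrite cards1 mul1r.
rewrite [leLHS]exchange_big [leRHS]exchange_big; apply: ler_sum => s _.
by rewrite !big_split /= cardQ.
Qed.

(** * Algorithms with finite randomness *)

(** The uniform distribution on [{0, ..., M}], seen on [nat], where every set is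
    measurable. *)
Definition uniform_nat (R : realType) (M : nat) : set nat -> \bar R :=
  mscale (M.+1%:R^-1)%:nng (msum (fun k => \d_k) M.+1).

HB.instance Definition _ (R : realType) (M : nat) :=
  Measure.on (@uniform_nat R M).

Lemma uniform_nat_setT (R : realType) (M : nat) :
  uniform_nat R M [set: nat] = 1%E.
Proof.
rewrite /uniform_nat /mscale/= /msum (eq_bigr (fun=> 1%:E)) => [|k _].
  by rewrite sumEFin sumr_const card_ord -EFinM mulVf ?pnatr_eq0.
exact: diracT.
Qed.

HB.instance Definition _ (R : realType) (M : nat) :=
  Measure_isProbability.Build _ _ _ (@uniform_nat R M) (uniform_nat_setT R M).

Lemma integral_uniform_nat (R : realType) (M : nat) (f : nat -> \bar R) :
  (forall k, 0 <= f k)%E ->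
  (\int[uniform_nat R M]_k f k = (M.+1%:R^-1)%:E * \sum_(k < M.+1) f k)%E.
Proof.
move=> f0; rewrite ge0_integral_mscale //= ge0_integral_measure_sum //.
congr (_ * _)%E; apply: eq_bigr => k _.
by rewrite integral_dirac // diracT mul1e.
Qed.

(** A uniform choice from a finite family of algorithms is a randomized
    algorithm: over [nat] all measurability conditions hold, and the countable
    set of outputs is separable. *)
Lemma finite_ran_alg (R : realType) (X K : Type) (G : zmodType)
    (Lam : set (X -> K)) (S : X -> G) (F : set X) (nG : G -> R) (n : nat)
    (W : finType) (B : W -> det_alg G Lam) (e : R) :
  (0 < #|W|)%N -> (forall x, 0 <= nG x) -> nG 0 = 0 ->
  (forall w f, F f -> (card_alg R (B w) f <= n%:R%:E)%E) ->
  (forall f, F f -> \sum_w nG (S f - run (B w) f) <= #|W|%:R * e) ->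
  exists (P : probability nat R) (A : nat -> det_alg G Lam),
    [/\ ran_class F nG n P A, forall k, range B (A k) &
        (ran_error S F nG P A <= e%:E)%E].
Proof.
move=> W_gt0 nG_ge0 nG0 cardB errB; case WE : #|W| W_gt0 => [//|M] _.
pose A k := B (enum_val (cast_ord (esym WE) (inord k))).
exists (uniform_nat R M), A; split.
- move=> f Ff; split=> //.
  + apply: (@le_trans _ _ (\int[uniform_nat R M]_w (n%:R)%:E)%E).
      apply: ge0_le_integral => //; last by move=> k _; exact: cardB.
      by move=> k _; rewrite /card_alg; case: stop_time => // i; rewrite lee_fin.
    by rewrite integral_cst //= probability_setT mule1.
  + exists (range (fun k => run (A k) f)); last by apply/aeW => k; exists k.
    exists (range (fun k => run (A k) f)); split=> //.
      exact: card_image_le.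
    move=> y e' yA e'0; exists y => //.
    by rewrite /ball_ /= subrr nG0.
- by move=> k; exists (enum_val (cast_ord (esym WE) (inord k))).
apply: ub_ereal_sup => _ [f Ff <-].
rewrite integral_uniform_nat; last by move=> k; rewrite lee_fin.
rewrite sumEFin -EFinM lee_fin ler_pdivrMl ?ltr0n //.
have := errB f Ff; rewrite WE; apply: le_trans.
rewrite [leRHS](reindex (fun k : 'I_M.+1 => enum_val (cast_ord (esym WE) k))) /=.
  by apply: ler_sum => k _; rewrite /A inord_val.
exists (fun w => cast_ord WE (enum_rank w)) => k _.
  by rewrite enum_valK cast_ordKV.
by rewrite cast_ordK enum_rankK.
Qed.

(** * Two-stage algorithms *)

Lemma point_evals_nth (V : Type) (N1 N2 : nat) (p0 : 'I_N1 * 'I_N2)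
    (r : seq ('I_N1 * 'I_N2)) (i : nat) :
  point_evals (fun f : 'M[V]_(N1, N2) => f (nth p0 r i).1 (nth p0 r i).2).
Proof. by exists (nth p0 r i).1, (nth p0 r i).2. Qed.

Definition two_stage_reads (V : Type) (N1 N2 : nat)
    (p : seq ('I_N1 * 'I_N2)) (sel : seq V -> seq ('I_N1 * 'I_N2))
    (f : 'M[V]_(N1, N2)) : seq ('I_N1 * 'I_N2) :=
  p ++ sel [seq f q.1 q.2 | q <- p].

(** The positions [p] are read first, and the answers determine through [sel]
    the positions that are read next. The list [reads a] is correct as soon as
    the first stage is complete, and during that stage only its prefix [p]
    matters. The output keeps the values that were read; at the other positions
    [index] is out of range and [nth] gives [0]. *)
Definition two_stage (V : zmodType) (N1 N2 : nat) (p0 : 'I_N1 * 'I_N2)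
    (p : seq ('I_N1 * 'I_N2)) (sel : seq V -> seq ('I_N1 * 'I_N2)) :
    det_alg 'M[V]_(N1, N2) (@point_evals V N1 N2) :=
  let reads (a : seq V) := p ++ sel (take (size p) a) in
  @DetAlg 'M[V]_(N1, N2) V 'M[V]_(N1, N2) (@point_evals V N1 N2)
    (fun i a f => f (nth p0 (reads a) i).1 (nth p0 (reads a) i).2)
    (fun i a => point_evals_nth V p0 (reads a) i)
    (fun i a => i == size (reads a))
    (fun i a => \matrix_(i, j) nth 0 a (index (i, j) (reads a))).

Section TwoStage.

Variables (V : zmodType) (N1 N2 : nat) (p0 : 'I_N1 * 'I_N2).
Variables (p : seq ('I_N1 * 'I_N2)) (sel : seq V -> seq ('I_N1 * 'I_N2)).

Local Notation A := (two_stage p0 p sel).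
Local Notation reads := (two_stage_reads p sel).
Local Notation vals f r := [seq f q.1 q.2 | q <- r].

Lemma two_stage_prefix (f : 'M[V]_(N1, N2)) (i : nat) : (size p <= i)%N ->
  p ++ sel (take (size p) (vals f (take i (reads f)))) = reads f.
Proof.
by move=> pi; rewrite -map_take take_takel // /two_stage_reads take_size_cat.
Qed.

Lemma two_stage_info (f : 'M[V]_(N1, N2)) (i : nat) :
  (i <= size (reads f))%N -> info A f i = vals f (take i (reads f)) :> seq V.
Proof.
elim: i => [|i IHi] i_lt; first by rewrite take0.
rewrite /= IHi ?(ltnW i_lt) // (take_nth p0) // map_rcons; congr rcons.
have [pi|ip] := leqP (size p) i; first by rewrite two_stage_prefix.
by rewrite /two_stage_reads !nth_cat ip.
Qed.

Lemma two_stage_stop_time (f : 'M[V]_(N1, N2)) :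
  stop_time A f = Some (size (reads f)).
Proof.
apply/stop_timeP; split=> [|i i_lt] /=.
  rewrite two_stage_info // two_stage_prefix //.
  by rewrite /two_stage_reads size_cat leq_addr.
rewrite two_stage_info ?(ltnW i_lt) //.
have [pi|ip] := leqP (size p) i; first by rewrite two_stage_prefix // ltn_eqF.
by rewrite size_cat ltn_eqF // ltn_addr.
Qed.

Lemma two_stage_run (f : 'M[V]_(N1, N2)) (i : 'I_N1) (j : 'I_N2) :
  run A f i j = if (i, j) \in reads f then f i j else 0.
Proof.
rewrite /run two_stage_stop_time /= mxE two_stage_info // two_stage_prefix.
  rewrite take_size; case: ifPn => [ij|]; last first.
    by rewrite -index_mem -leqNgt => ij; rewrite nth_default // size_map.
  by rewrite (nth_map p0) ?index_mem // nth_index.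
by rewrite /two_stage_reads size_cat leq_addr.
Qed.

End TwoStage.

(** * Screening the rows *)

(** Stage one reads the columns [w] of every row; a row that shows there an
    entry of modulus at least [C] is then read completely. *)
Section Screening.

Variables (R : realType) (V : normedZmodType R) (N1 N2 m : nat) (C : R).
Variables (p0 : 'I_N1 * 'I_N2) (w : {ffun 'I_m -> 'I_N2}).

Definition screen_pos : seq ('I_N1 * 'I_N2) :=
  [seq (i, w k) | i <- enum 'I_N1, k <- enum 'I_m].

Definition screen_sel (a : seq V) : seq ('I_N1 * 'I_N2) :=
  [seq (i, j) | i <- [seq i <- enum 'I_N1 |
     has (fun qv => (qv.1.1 == i) && (C <= `|qv.2|)) (zip screen_pos a)],
   j <- enum 'I_N2].

Definition screening := two_stage p0 screen_pos screen_sel.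

Definition hit (f : 'M[V]_(N1, N2)) (i : 'I_N1) : bool :=
  [exists k, C <= `|f i (w k)|].

Lemma screen_selE (f : 'M[V]_(N1, N2)) :
  screen_sel [seq f q.1 q.2 | q <- screen_pos]
  = [seq (i, j) | i <- [seq i <- enum 'I_N1 | hit f i], j <- enum 'I_N2].
Proof.
rewrite /screen_sel; congr allpairs; apply: eq_filter => i.
rewrite -{1}(map_id screen_pos) zip_map has_map.
apply/hasP/existsP => [[q /allpairsP[[i' k] /= [_ _ ->]] /andP[/eqP <-]]|[k ik]].
  by exists k.
exists (i, w k); last by rewrite /= eqxx.
by apply/allpairsP; exists (i, k); rewrite !mem_enum.
Qed.

Lemma card_screening (f : 'M[V]_(N1, N2)) :
  card_alg R screening f
  = (N1 * m + #|[pred i | hit f i]| * N2)%:R%:E.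
Proof.
rewrite /card_alg two_stage_stop_time /two_stage_reads size_cat screen_selE.
rewrite !size_allpairs !size_enum_ord; congr (_ + _ * _)%:R%:E.
by rewrite enumT cardE /enum_mem; congr size; apply: eq_filter.
Qed.

(** In a row that is not hit the screened entries are known too; the bound
    ignores this gain. *)
Lemma screening_err (f : 'M[V]_(N1, N2)) (i : 'I_N1) (j : 'I_N2) :
  `|(f - run screening f) i j| <= if hit f i then 0 else `|f i j|.
Proof.
rewrite 2!mxE [fun_of_matrix (run _ _) _ _]two_stage_run mem_cat screen_selE.
case: (boolP (hit f i)) => fi; last first.
  by case: ifP; rewrite ?subrr ?normr0 ?subr0.
rewrite ifT ?subrr ?normr0 //; apply/orP; right.
by apply/allpairsP; exists (i, j); rewrite mem_filter fi !mem_enum.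
Qed.

End Screening.

Lemma ball_sum_max (R : realType) (V : normedZmodType R) (N1 N2 : nat)
    (f : 'M[V]_(N1, N2)) :
  (0 < N1)%N -> mixed_ball 1%:E +oo%E f ->
  \sum_(i < N1) \big[Num.max/0]_(j < N2) `|f i j| <= N1%:R.
Proof.
move=> N1_gt0; rewrite /mixed_ball /mkset mixed_norm_1ooE.
by rewrite ler_pdivrMl ?ltr0n // mulr1.
Qed.

Lemma ball_entry_le (R : realType) (V : normedZmodType R) (N1 N2 : nat)
    (f : 'M[V]_(N1, N2)) (i : 'I_N1) (j : 'I_N2) :
  (0 < N1)%N -> mixed_ball 1%:E +oo%E f -> `|f i j| <= N1%:R.
Proof.
move=> N1_gt0 /(ball_sum_max N1_gt0); apply: le_trans.
apply: (@le_trans _ _ (\big[Num.max/0]_(j < N2) `|f i j|)).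
  exact: (le_bigmax _ (fun j => `|f i j|)).
rewrite [leRHS](bigD1 i) //= lerDl.
by apply: sumr_ge0 => i' _; exact: bigmax_ge_id.
Qed.

(** A hit row has maximum at least [C], and the maxima of all rows add up to at
    most [N1]. *)
Lemma hit_count (R : realType) (V : normedZmodType R) (N1 N2 m : nat) (C : R)
    (w : {ffun 'I_m -> 'I_N2}) (f : 'M[V]_(N1, N2)) :
  (0 < N1)%N -> 0 <= C -> mixed_ball 1%:E +oo%E f ->
  C * #|[pred i | hit C w f i]|%:R <= N1%:R.
Proof.
move=> N1_gt0 C0 Ff; apply: le_trans (ball_sum_max N1_gt0 Ff).
rewrite -sum1_card natr_sum mulr_sumr big_mkcond; apply: ler_sum => i _.
rewrite mulr1; case: ifP => [/existsP[k fk]|_]; last exact: bigmax_ge_id.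
by apply: le_trans fk _; exact: (le_bigmax _ (fun j => `|f i j|)).
Qed.

Lemma card_misses (R : realType) (V : normedZmodType R) (N1 N2 m : nat) (C : R)
    (f : 'M[V]_(N1, N2)) (i : 'I_N1) :
  #|[pred w : {ffun 'I_m -> 'I_N2} | ~~ hit C w f i]|
  = (#|[pred j | ~~ (C <= `|f i j|)%R]| ^ m)%N.
Proof.
rewrite -[X in (_ ^ X)%N]card_ord -card_ffun_on; apply: eq_card => w.
rewrite inE /hit negb_exists.
by apply/forallP/ffun_onP => miss k; have := miss k; rewrite inE.
Qed.

(** The columns are independent: if the large entries fill more than a fraction
    [t / N1] of the row, all [N1] columns miss them with probability at most
    [(1 - t / N1) ^ N1 <= expR (- t)]. *)
Lemma heavy_row_missed (R : realType) (V : normedZmodType R) (N1 N2 : nat)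
    (C t : R) (f : 'M[V]_(N1, N2)) (i : 'I_N1) :
  (0 < N1)%N -> t * N2%:R < N1%:R * #|[pred j | C <= `|f i j|]|%:R ->
  #|[pred w : {ffun 'I_N1 -> 'I_N2} | ~~ hit C w f i]|%:R
  <= #|{ffun 'I_N1 -> 'I_N2}|%:R * expR (- t).
Proof.
move=> N1_gt0 heavy.
have N1_gt0' : 0 < N1%:R :> R by rewrite ltr0n.
rewrite card_misses card_ffun !card_ord !natrX.
have -> : expR (- t) = expR (- t / N1%:R) ^+ N1.
  by rewrite -expRM_natl mulrC divfK ?gt_eqF.
rewrite -exprMn lerXn2r ?nnegrE ?mulr_ge0 ?expR_ge0 //.
have := expR_ge1Dx (- t / N1%:R) => /(ler_wpM2l (ler0n _ N2)).
apply: le_trans; rewrite mulNr mulrBr mulr1 lerBrDr.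
have := cardC [pred j | C <= `|f i j|]; rewrite card_ord => N2E.
rewrite -[X in _ <= X%:R]N2E addnC natrD lerD2l.
by rewrite mulrA ler_pdivrMr // mulrC [leRHS]mulrC ltW // mulrC.
Qed.

(** Entries below [C] contribute at most [C] to the mean, the others have modulus
    at most [N1]. *)
Lemma light_row_le (R : realType) (V : normedZmodType R) (N1 N2 : nat)
    (C : R) (f : 'M[V]_(N1, N2)) (i : 'I_N1) :
  (0 < N1)%N -> (0 < N2)%N -> 0 <= C -> mixed_ball 1%:E +oo%E f ->
  N2%:R^-1 * \sum_j `|f i j|
  <= C + N1%:R * #|[pred j | C <= `|f i j|]|%:R / N2%:R.
Proof.
move=> N1_gt0 N2_gt0 C0 Ff; rewrite ler_pdivrMl ?ltr0n // mulrDr.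
rewrite mulrCA mulfV ?pnatr_eq0 -?lt0n // mulr1.
rewrite -sum1_card natr_sum mulr_sumr [N2%:R * C]mulr_natl.
rewrite -[X in _ *+ X](card_ord N2) -sumr_const [X in _ + X]big_mkcond -big_split.
apply: ler_sum => j _ /=; rewrite mulr1 inE; case: (leP C `|f i j|) => [_|/ltW fC].
  by rewrite (le_trans (ball_entry_le i j N1_gt0 Ff)) // lerDr.
by rewrite addr0.
Qed.

(** A row is lost only if the random columns miss all its large entries.
    Light rows, where the large entries contribute at most [t] to the mean, may
    be lost; a heavy row is lost with probability at most [expR (- t)]. *)
Lemma screening_mean_error (R : realType) (V : normedZmodType R)
    (N1 N2 : nat) (C t : R) (p0 : 'I_N1 * 'I_N2) (f : 'M[V]_(N1, N2)) :
  (0 < N1)%N -> (0 < N2)%N -> 0 <= C -> 0 <= t ->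
  mixed_ball 1%:E +oo%E f ->
  \sum_(w : {ffun 'I_N1 -> 'I_N2})
    mixed_norm +oo%E 1%:E (f - run (screening V C p0 w) f)
  <= #|{ffun 'I_N1 -> 'I_N2}|%:R * (C + t + N1%:R * (N1%:R * expR (- t))).
Proof.
move=> N1_gt0 N2_gt0 C0 t0 Ff.
pose heavy i := t * N2%:R < N1%:R * #|[pred j | C <= `|f i j|]|%:R.
apply: (@le_trans _ _ (\sum_(w : {ffun 'I_N1 -> 'I_N2})
    (C + t + N1%:R * \sum_(i | heavy i) (~~ hit C w f i)%:R))).
  apply: ler_sum => w _.
  have lost0 : 0 <= N1%:R * (\sum_(i | heavy i) (~~ hit C w f i)%:R) :> R.
    by rewrite mulr_ge0 ?sumr_ge0.
  apply: mixed_norm_oo1_le => [|i]; first by rewrite !addr_ge0.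
  have [fi|fi] := boolP (hit C w f i).
    rewrite big1 ?mulr0 ?addr_ge0 // => j _.
    by apply/le_anti; rewrite normr_ge0 andbT;
       have := screening_err C p0 w f i j; rewrite fi.
  apply: (@le_trans _ _ (N2%:R^-1 * \sum_j `|f i j|)).
    rewrite ler_wpM2l ?invr_ge0 // ler_sum // => j _.
    by have := screening_err C p0 w f i j; rewrite (negPf fi).
  have [heavy_i|light_i] := ltP (t * N2%:R) (N1%:R * #|[pred j | C <= `|f i j|]|%:R).
    apply: (@le_trans _ _ N1%:R).
      rewrite ler_pdivrMl ?ltr0n // mulr_natl.
      rewrite -[X in _ *+ X](card_ord N2) -sumr_const.
      by apply: ler_sum => j _; exact: ball_entry_le.
    rewrite ler_wpDl ?addr_ge0 // (bigD1 i) //= fi mulrDr mulr1 lerDl.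
    by rewrite mulr_ge0 ?sumr_ge0.
  apply: le_trans (light_row_le i N1_gt0 N2_gt0 C0 Ff) _.
  by rewrite -addrA lerD2l ler_wpDr // ler_pdivrMr ?ltr0n.
rewrite big_split /= sumr_const -[X in X + _]mulr_natl -mulr_sumr exchange_big /=.
rewrite [leRHS]mulrDr lerD2l mulrCA ler_wpM2l // mulrCA.
apply: (@le_trans _ _ (\sum_(i < N1)
    #|{ffun 'I_N1 -> 'I_N2}|%:R * expR (- t))); last first.
  by rewrite sumr_const card_ord -[leLHS]mulr_natl.
rewrite big_mkcond; apply: ler_sum => i _.
case: ifP => [heavy_i|_]; last by rewrite mulr_ge0 ?expR_ge0.
apply: le_trans (heavy_row_missed N1_gt0 heavy_i).
rewrite -natr_sum ler_nat -sum1_card [leqRHS]big_mkcond.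
by apply: leq_sum => w _; rewrite inE; case: (hit C w f i).
Qed.

(** * Upper bounds for the minimal errors *)

(** The algorithm that reads nothing and returns zero, an instance of
    [two_stage] with two empty stages, is in both classes. *)
Lemma e_ran_le_zero (R : realType) (V : normedZmodType R) (N1 N2 n : nat) :
  (0 < N1)%N -> (0 < N2)%N ->
  (e_ran (@point_evals V N1 N2) (@J V N1 N2)
     (mixed_ball 1%:E +oo%E) (mixed_norm +oo%E 1%:E) n <= N1%:R%:E)%E /\
  (e_ran_non (@point_evals V N1 N2) (@J V N1 N2)
     (mixed_ball 1%:E +oo%E) (mixed_norm +oo%E 1%:E) n <= N1%:R%:E)%E.
Proof.
move=> N1_gt0 N2_gt0.
pose zero_alg (_ : unit) : det_alg 'M[V]_(N1, N2) (@point_evals V N1 N2) :=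
  two_stage (Ordinal N1_gt0, Ordinal N2_gt0) [::] (fun=> [::]).
have [|||w f Ff|f Ff|P [A [clA rangeA errA]]] := @finite_ran_alg R _ _ _ _
  (@J V N1 N2) (mixed_ball 1%:E +oo%E) (mixed_norm +oo%E 1%:E) n unit
  zero_alg N1%:R.
- by rewrite card_unit.
- exact: mixed_norm_oo1_ge0.
- exact: mixed_norm_oo1_0.
- by rewrite /card_alg two_stage_stop_time lee_fin.
- rewrite (big_pred1 tt) ?card_unit ?mul1r; last by case.
  apply: mixed_norm_oo1_le => // i; rewrite ler_pdivrMl ?ltr0n // mulr_natl.
  rewrite -[X in _ *+ X](card_ord N2) -sumr_const.
  apply: ler_sum => j _.
  by rewrite 2!mxE [fun_of_matrix (run _ _) _ _]two_stage_run subr0 ball_entry_le.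
split; apply: le_trans (ereal_inf_lbound _) errA; exists _, _, P, A; split=> //.
by move=> k; have [? _ <-] := rangeA k.
Qed.

(** Threshold [16] balances the two stages: screening costs [s * s], and at most
    [s / 16] rows of length [16 * s] are read completely. *)
Lemma e_ran_le_screening (R : realType) (V : normedZmodType R) (s n : nat) :
  (0 < s)%N -> (2 * s ^ 2 <= n)%N ->
  (e_ran (@point_evals V s (16 * s)) (@J V s (16 * s))
     (mixed_ball 1%:E +oo%E) (mixed_norm +oo%E 1%:E) n
   <= (17 + 2 * ln s%:R)%:E)%E.
Proof.
move=> s_gt0 sn; have s16_gt0 : (0 < 16 * s)%N by rewrite muln_gt0.
have s_gt0' : 0 < s%:R :> R by rewrite ltr0n.
pose alg := screening V 16 (Ordinal s_gt0, Ordinal s16_gt0) (m := s).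
have [|||||P [A [clA rangeA errA]]] := @finite_ran_alg R _ _ _ _
  (@J V s (16 * s)) (mixed_ball 1%:E +oo%E) (mixed_norm +oo%E 1%:E) n
  {ffun 'I_s -> 'I_(16 * s)} alg (17 + 2 * ln s%:R).
- by rewrite card_ffun !card_ord expn_gt0 s16_gt0.
- exact: mixed_norm_oo1_ge0.
- exact: mixed_norm_oo1_0.
- move=> w f Ff; rewrite card_screening lee_fin ler_nat.
  have := hit_count w s_gt0 (ler0n R 16) Ff.
  rewrite -natrM ler_nat => hits; apply: leq_trans sn.
  by rewrite mul2n -addnn mulnA leq_add2l [(#|_| * 16)%N]mulnC leq_mul2r hits orbT.
- move=> f Ff; have ln_s_ge0 : 0 <= 2 * ln s%:R :> R.
    by rewrite mulr_ge0 // ln_ge0 // ler1n.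
  have := screening_mean_error (Ordinal s_gt0, Ordinal s16_gt0)
    s_gt0 s16_gt0 (ler0n R 16) ln_s_ge0 Ff.
  (* The slack [2 * ln s] makes the union bound over the heavy rows equal 1. *)
  have expE : expR (- (2 * ln s%:R)) = s%:R^-1 * s%:R^-1 :> R.
    by rewrite expRN mulr_natl mulr2n expRD lnK ?posrE // invfM.
  rewrite expE mulVKf ?gt_eqF // mulfV ?gt_eqF // => /le_trans; apply.
  by rewrite ler_wpM2l //; lra.
apply: le_trans (ereal_inf_lbound _) errA.
by exists _, _, P, A.
Qed.

(** * The ratio of the minimal errors *)

Lemma ratio_bounds (R : realType) (x y : \bar R) (a b l u : R) :
  0 < b -> 0 <= l ->
  ((a / 2)%:E <= x)%E -> (x <= a%:E)%E ->
  ((1 / 2)%:E <= y)%E -> (y <= b%:E)%E ->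
  l * b <= a / 2 -> 2 * a <= u ->
  (l%:E <= x / y <= u%:E)%E.
Proof.
move=> b0 l0; case: x => [x| |] //; case: y => [y| |] //.
rewrite !lee_fin => ax xa y2 yb lb au.
have y0 : 0 < y by lra.
rewrite inver gt_eqF // -EFinM !lee_fin ler_pdivlMr // ler_pdivrMr //.
have : l * y <= l * b by rewrite ler_wpM2l.
have : 0 <= u * (y - 1 / 2) by rewrite mulr_ge0 //; [have := mulr_ge0 l0 (ltW b0); lra | lra].
by move=> *; apply/andP; split; lra.
Qed.

Lemma scalars_unit (R : realType) (k : scalar_kind) :
  exists u : scalars R k, `|u| = 1.
Proof.
case: k => /=; first by exists (1 : R); rewrite normr1.
by exists (1 : Rcomplex R); rewrite /Num.norm /= expr1n expr0n addr0 sqrtr1.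
Qed.

Lemma sqrt_scale (n : nat) : (1 < n)%N ->
  exists s, [/\ (0 < s)%N, (2 * s ^ 2 <= n)%N & (n <= 8 * s ^ 2)%N].
Proof.
move=> n_gt1.
have ex : exists s, (2 * s ^ 2 <= n)%N by exists 1%N.
have ub s : (2 * s ^ 2 <= n)%N -> (s <= n)%N by nia.
case: (ex_maxnP ex ub) => s sn s_max; have := s_max 1%N n_gt1 => s_gt0.
exists s; split=> //; rewrite leqNgt; apply/negP => n_big.
have /s_max : (2 * s.+1 ^ 2 <= n)%N by nia.
by rewrite ltnn.
Qed.

Theorem corollary1 (R : realType) (k : scalar_kind) :
  exists c1 c2 : R, [/\ 0 < c1, 0 < c2 &
    forall n : nat, (0 < n)%N ->
    exists N1 N2 : nat, [/\ (0 < N1)%N, (0 < N2)%N &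
      let K := scalars R k in
      let F : set 'M[K]_(N1, N2) := mixed_ball 1%:E +oo%E in
      let normG : 'M[K]_(N1, N2) -> R := mixed_norm +oo%E 1%:E in
      let Lam := @point_evals K N1 N2 in
      let S := @J K N1 N2 in
      ((c1 * Num.sqrt n%:R * (log2 n.+1%:R)^-1)%:E
         <= e_ran_non Lam S F normG n / e_ran Lam S F normG n
         <= (c2 * Num.sqrt n%:R)%:E)%E ]].
Proof.
have [u u1] := scalars_unit R k.
have ln2_gt0 : 0 < ln 2 :> R by rewrite ln_gt0 // ltr1n.
(* 114 = 2 * 3 * 19, from [e' >= s / 2], [sqrt n <= 3 * s] and
   [17 + 2 * ln s <= 19 * log2 (n + 1)]. *)
exists (1 / 114), 2; split=> [||n n_gt0]; [lra | lra |].
have log_ge1 : 1 <= log2 n.+1%:R :> R.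
  by rewrite /log2 ler_pdivlMr // mul1r ler_ln ?posrE ?ltr0n // ler_nat ltnS.
have log_gt0 : 0 < log2 n.+1%:R :> R by lra.
have sqrt_ge0 : 0 <= Num.sqrt n%:R :> R by exact: sqrtr_ge0.
have lower_ge0 : 0 <= 1 / 114 * Num.sqrt n%:R * (log2 n.+1%:R)^-1 :> R.
  by rewrite !mulr_ge0 ?invr_ge0 // ltW.
have [n_gt1|n_le1] := ltnP 1 n; last first.
  have n1 : n = 1%N by apply/eqP; rewrite eqn_leq n_le1 n_gt0.
  subst n.
  exists 1%N, 2; split=> // K F normG Lam S.
  have [ran_le non_le] := @e_ran_le_zero R K 1 2 1 isT isT.
  apply: (@ratio_bounds R _ _ 1%:R 1%:R) => //.
  - exact: (e_ran_non_ge u1).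
  - exact: (e_ran_ge u1).
  - rewrite mulrAC ler_pdivrMr // sqrtr1; lra.
  - by rewrite sqrtr1.
have [s [s_gt0 s_le s_ge]] := sqrt_scale n_gt1.
exists s, (16 * s)%N; split=> //; first by rewrite muln_gt0.
move=> K F normG Lam S.
have N2_gt0 : (0 < 16 * s)%N by rewrite muln_gt0.
have nN : (2 * n <= s * (16 * s))%N by lia.
have [_ non_le] := @e_ran_le_zero R K s (16 * s) n s_gt0 N2_gt0.
have ran_le := @e_ran_le_screening R K s n s_gt0 s_le.
have s_ge1 : 1 <= s%:R :> R by rewrite ler1n.
have sqrt_ge : s%:R <= Num.sqrt n%:R :> R.
  rewrite -(@ler_pXn2r _ 2) ?nnegrE // sqr_sqrtr // -natrX ler_nat; lia.
have sqrt_le : Num.sqrt n%:R <= 3 * s%:R :> R.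
  rewrite -(@ler_pXn2r _ 2) ?nnegrE ?mulr_ge0 // sqr_sqrtr // exprMn -!natrX.
  by rewrite -natrM ler_nat; lia.
have ln_s_ge0 : 0 <= ln s%:R :> R by rewrite ln_ge0.
have ln_s_le : ln s%:R <= log2 n.+1%:R :> R.
  have ln2_le1 : ln 2 <= 1 :> R by apply: (le_ln1Dx (x := 1)); lra.
  have : ln s%:R <= ln n.+1%:R :> R.
    by rewrite ler_ln ?posrE ?ltr0n // ler_nat; nia.
  move=> /le_trans; apply; rewrite /log2 ler_pdivlMr // ler_piMr //.
  by rewrite ln_ge0 // ler1n.
apply: (@ratio_bounds R _ _ s%:R (17 + 2 * ln s%:R)) => //; first by lra.
- exact: (e_ran_non_ge u1).
- exact: (e_ran_ge u1).
- rewrite mulrAC ler_pdivrMr //.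
  have := ler_wpM2l sqrt_ge0 ln_s_le.
  nra.
- nra.
Qed.
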